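(* Let $G$ be a finite, simple, undirected graph with $n$ vertices, average degree $d$, minimum degree at least $\delta$, and maximum degree at most $\Delta$, where $\delta$ and $\Delta$ are integers and $0\leq\delta<d<\Delta<n$. Then $$s(G)\leq \frac{2n(\Delta-d)(d-\delta)}{\Delta-\delta}.$$
   Context: For a graph $G$ with vertex set $V(G)$, $n$ vertices and $m$ edges, the average degree is $d=\frac{2m}{n}$, and the degree deviation of $G$ is $s(G)=\sum_{u\in V(G)}|d_G(u)-d|$, where $d_G(u)$ is the degree of $u$ in $G$. The numbers $\delta$ and $\Delta$ are only bounds on the degrees; $G$ need not contain vertices of these degrees. *)

(* Defs.v *)
From mathcomp Require Import all_boot all_order all_algebra.

Set Implicit Arguments.
Unset Strict Implicit.
Unset Printing Implicit Defensive.

Import Order.TTheory GRing.Theory Num.Theory.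

Local Open Scope ring_scope.

Record sgraph := SGraph {
  vertex :> finType;
  adj : rel vertex;
  adj_sym : symmetric adj;
  adj_irrefl : irreflexive adj
}.

Definition degree (G : sgraph) (u : G) : nat := #|[set v | adj u v]|.

(* Edges are unordered pairs, so each one is counted once in [#|edges G|]. *)
Definition edges (G : sgraph) : {set {set G}} :=
  [set [set u; v] | u in G, v in G & adj u v].

(* The average degree and the degree deviation are rational numbers. On the
   graph without vertices, [avg_degree] is 0 by the convention for [0^-1]. *)
Definition avg_degree (G : sgraph) : rat :=
  2 * #|edges G|%:R / #|G|%:R.

Definition deg_deviation (G : sgraph) : rat :=
  \sum_(u : G) `|(degree u)%:R - avg_degree G|.

(* Main.v *)
Require Import Defs.
From mathcomp Require Import all_boot all_order all_algebra.
From mathcomp Require Import ring lra.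

(** The function [x |-> |x - d|] is convex, so on [[delta, Delta]] it lies below
    its chord, the affine function
    [((Delta - x) (d - delta) + (x - delta) (Delta - d)) / (Delta - delta)].
    Since the degrees sum to [n d], summing the chord over all vertices gives
    [n] times its value at [d]. *)

Import Order.TTheory GRing.Theory Num.Theory.

Local Open Scope ring_scope.

Lemma edgesP (G : sgraph) (e : {set G}) :
  reflect (exists2 p : G * G, adj p.1 p.2 & e = [set p.1; p.2]) (e \in edges G).
Proof.
apply: (iffP imset2P) => [[u v _]|[[u v] /= uv ->]].
  by rewrite !inE /= => uv ->; exists (u, v).
by exists u v; rewrite ?inE.
Qed.

Lemma set2_eq (T : finType) (x y u v : T) :
  ([set x; y] == [set u; v]) =
  ((x, y) == (u, v)) || ((x, y) == (v, u)).
Proof.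
apply/eqP/orP => [eq_xy|[/eqP[-> ->]|/eqP[-> ->]]] //; last exact: setUC.
have: x \in [set u; v] by rewrite -eq_xy set21.
have: y \in [set u; v] by rewrite -eq_xy set22.
have: u \in [set x; y] by rewrite eq_xy set21.
have: v \in [set x; y] by rewrite eq_xy set22.
by do 4![case/set2P=> ?]; subst; rewrite ?eqxx; auto.
Qed.

(** Double counting: the degrees count ordered adjacent pairs, and these are grouped by their
    underlying edge, with two pairs in each fibre. *)
Lemma sum_degree (G : sgraph) : (\sum_(u : G) degree u = 2 * #|edges G|)%N.
Proof.
under eq_bigr => u _ do rewrite /degree cardsE -sum1_card.
rewrite pair_big_dep /=.
rewrite (partition_big (fun p : G * G => [set p.1; p.2]) (mem (edges G))) /=;
  last by move=> p uv; apply/edgesP; exists p.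
rewrite mulnC -sum_nat_const; apply: eq_bigr => _ /edgesP[[u v] /= uv ->].
(* Irreflexivity makes the two orientations of an edge distinct, so the fibre has exactly two
   elements. *)
have neq_uv : (u, v) != (v, u).
  by apply: contraTneq uv => -[-> _]; rewrite adj_irrefl.
rewrite -[RHS](_ : #|[set (u, v); (v, u)]| = 2%N); last by rewrite cards2 neq_uv.
rewrite -sum1_card; apply: eq_bigl => -[x y]; rewrite /= set2_eq !inE.
apply: andb_idl => /orP[] /eqP[-> ->] //.
by rewrite /in_mem /= adj_sym.
Qed.

Lemma sum_degree_avg (G : sgraph) :
  \sum_(u : G) (degree u)%:R = #|G|%:R * avg_degree G.
Proof.
rewrite -natr_sum sum_degree natrM /avg_degree.
(* Without vertices the division cannot be cancelled, but there are no edges and both sides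
   vanish. *)
have [G0|Gn0] := eqVneq #|G| 0%N.
  have -> : edges G = set0.
    apply/setP => e; rewrite inE; apply/negP => /edgesP[[u _] _ _].
    by move/card0_eq/(_ u): G0.
  by rewrite cards0 mulr0 mul0r mulr0.
by rewrite [RHS]mulrC divfK ?pnatr_eq0.
Qed.

Lemma dist_le_chord (R : realFieldType) (a b d x : R) :
  a < d -> d < b -> a <= x -> x <= b ->
  `|x - d| <= ((b - x) * (d - a) + (x - a) * (b - d)) / (b - a).
Proof.
move=> ad db ax xb; rewrite ler_pdivlMr; last by lra.
have bx_da : 0 <= (b - x) * (d - a) by rewrite mulr_ge0 // subr_ge0 // ltW.
have xa_bd : 0 <= (x - a) * (b - d) by rewrite mulr_ge0 // subr_ge0 // ltW.
(* With the denominator cleared, the gap is twice one of the two products above: the first if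
   [x >= d], the second if [x < d]. *)
rewrite -subr_ge0; case: (ger0P (x - d)) => _.
  by rewrite [leRHS](_ : _ = 2 * ((b - x) * (d - a))); [rewrite mulr_ge0|ring].
by rewrite [leRHS](_ : _ = 2 * ((x - a) * (b - d))); [rewrite mulr_ge0|ring].
Qed.

Lemma sum_dist_mean_le (R : realFieldType) (I : finType) (f : I -> R)
    (a b d : R) :
  a < d -> d < b -> (forall i, a <= f i) -> (forall i, f i <= b) ->
  \sum_i f i = #|I|%:R * d ->
  \sum_i `|f i - d| <= 2 * #|I|%:R * (b - d) * (d - a) / (b - a).
Proof.
move=> ad db af fb sum_f.
have chord i := dist_le_chord _ _ _ _ _ ad db (af i) (fb i).
apply: le_trans (ler_sum _ (fun i _ => chord i)) _.
rewrite -mulr_suml big_split /= -!mulr_suml !sumrB sum_f !sumr_const.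
(* The summed chord equals the bound exactly; only the pointwise estimate loses anything. *)
rewrite -[b *+ _]mulr_natl -[a *+ _]mulr_natl le_eqVlt; apply/orP; left.
by apply/eqP; congr (_ / _); ring.
Qed.

Theorem theorem1 (G : sgraph) (delta Delta : int)
  (min_deg : forall u : G, delta <= (degree u)%:Z)
  (max_deg : forall u : G, (degree u)%:Z <= Delta)
  (delta_ge0 : 0 <= delta)
  (delta_lt_d : delta%:Q < avg_degree G)
  (d_lt_Delta : avg_degree G < Delta%:Q)
  (Delta_lt_n : Delta < #|G|%:Z) :
  deg_deviation G <=
    2 * #|G|%:R * (Delta%:Q - avg_degree G) * (avg_degree G - delta%:Q)
      / (Delta%:Q - delta%:Q).
Proof.
apply: sum_dist_mean_le => // [u|u|]; last exact: sum_degree_avg.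
  (* The rational cast of a natural number is convertible to its cast through [int], where the
     degree bounds live. *)
  by rewrite -[(degree u)%:R]/((degree u)%:Z%:~R) ler_int.
by rewrite -[(degree u)%:R]/((degree u)%:Z%:~R) ler_int.
Qed.
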